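(* There exist infinitely many tuples $(a_0,a_1,a_2,a_3)$ of integers with $a_0\ge 0$, $a_1,a_2,a_3\ge 1$, $\gcd(a_0,a_1,a_2,a_3)=1$, $H(a_0;a_1,a_2,a_3)\subset\mathcal{S}$ and $a_1=a_2<a_3$. Moreover, there is a constant $c>0$ such that, for all sufficiently large $N$, the number of such tuples with $a_i\le N$ for $i=0,1,2,3$ is at least $c\,N^{1/10}$. The same statements (infinitude and the lower bound of the form $c\,N^{1/10}$ with some constant $c>0$) hold with the condition $a_1=a_2<a_3$ replaced by $a_1<a_2=a_3$.
   Context: $\mathcal{S}=\{n^2 : n\in\mathbb{N}\}$ is the set of integer squares ($\mathbb{N}$ contains $0$). The Hilbert cube of dimension $3$ is $H(a_0;a_1,a_2,a_3)=\{a_0+\varepsilon_1a_1+\varepsilon_2a_2+\varepsilon_3a_3 : \varepsilon_i\in\{0,1\}\}$. A Hilbert cube is called reduced if $\gcd(a_0,a_1,a_2,a_3)=1$. *)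

(* Defs.v *)
From HB Require Import structures.
From mathcomp Require Import all_boot all_order all_algebra.
From mathcomp Require Import finmap.
From mathcomp Require Import all_classical all_reals all_analysis.
Set Implicit Arguments.
Unset Strict Implicit.
Unset Printing Implicit Defensive.
Import Order.TTheory GRing.Theory Num.Theory.
Local Open Scope classical_set_scope.
Local Open Scope ring_scope.

Definition squares : set int := [set n%:Z ^+ 2 | n in [set: nat]].

Definition hilbert_cube (a0 a1 a2 a3 : int) : set int :=
  [set x | exists e1 e2 e3 : bool,
     x = a0 + e1%:R * a1 + e2%:R * a2 + e3%:R * a3].

Definition reduced (a0 a1 a2 a3 : int) : Prop :=
  gcdz a0 (gcdz a1 (gcdz a2 a3)) = 1.

Definition quadruple : Type := (int * int * int * int)%type.

Definition reduced_square_cubes : set quadruple :=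
  [set t | let: (a0, a1, a2, a3) := t in
     [/\ 0 <= a0, [/\ 1 <= a1, 1 <= a2 & 1 <= a3],
         reduced a0 a1 a2 a3 &
         hilbert_cube a0 a1 a2 a3 `<=` squares]].

Definition first_two_equal : set quadruple :=
  [set t | let: (_, a1, a2, a3) := t in a1 = a2 /\ a2 < a3].

Definition last_two_equal : set quadruple :=
  [set t | let: (_, a1, a2, a3) := t in a1 < a2 /\ a2 = a3].

Definition box (N : nat) : set quadruple :=
  [set t | let: (a0, a1, a2, a3) := t in
     [/\ a0 <= N%:Z, a1 <= N%:Z, a2 <= N%:Z & a3 <= N%:Z]].

(* [fset_set] is the empty set on infinite sets; this is harmless when the
   elements of [A] have nonnegative coordinates, as then [A `&` box N] is finite. *)
Definition count_upto (A : set quadruple) (N : nat) : nat :=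
  #|` fset_set (A `&` box N)|%fset.

(* Main.v *)
Require Import Defs.
From HB Require Import structures.
From mathcomp Require Import all_boot all_order all_algebra.
From mathcomp Require Import finmap.
From mathcomp Require Import all_classical all_reals all_analysis.
From mathcomp Require Import ring lra.
Set Implicit Arguments.
Unset Strict Implicit.
Unset Printing Implicit Defensive.
Import Order.TTheory GRing.Theory Num.Theory.
Local Open Scope classical_set_scope.
Local Open Scope ring_scope.

(** The cubes with two equal steps [d] and third step [h] are the pairs of
    three-term progressions of squares with the same difference [d], whose first
    terms differ by [h].  The progressions of squares are
    [(p^2 - q^2 - 2pq)^2, (p^2 + q^2)^2, (p^2 - q^2 + 2pq)^2], of difference
    [4pq(p^2 - q^2)].  If [m^2 = n^2 + nl + l^2], then [(m, l)], [(m, n)] and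
    [(n + l, m)] give the same difference [4mnl(n + l)] (Diophantus' right
    triangles of equal area).  Taking [(m, l)] for the lower progression,
    [(m, n)] for the upper one makes [h < d] when [n] is close to [l], while
    [(n + l, m)] makes [h > d].  A polynomial solution in one parameter [t], of
    degree 2, yields cubes with entries [O(t^8)], hence at least [c N^(1/8)] of
    them up to [N]. *)

(** * Counting an injective family of tuples of polynomial growth *)

Lemma finite_box (A : set quadruple) (N : nat) :
  (forall a0 a1 a2 a3, A (a0, a1, a2, a3) ->
     [/\ 0 <= a0, 0 <= a1, 0 <= a2 & 0 <= a3]) ->
  finite_set (A `&` box N).
Proof.
move=> A_ge0; pose I := [set n%:Z | n in `I_N.+1].
have finI : finite_set I by apply/finite_image/finite_II.
have inI (a : int) : 0 <= a -> a <= N%:Z -> I a.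
  by case: a => // n _ leN; exists n.
apply: (@sub_finite_set _ _ (I `*` I `*` I `*` I)).
  move=> [[[a0 a1] a2] a3] [/A_ge0[? ? ? ?] [? ? ? ?]].
  by split; [split; [split|]|]; apply: inI.
by do 3 apply: finite_setX => //.
Qed.

Lemma leq_count_upto (A : set quadruple) (f : nat -> quadruple) (T N : nat) :
  injective f -> finite_set (A `&` box N) ->
  (forall k, (k < T)%N -> (A `&` box N) (f k)) -> (T <= count_upto A N)%N.
Proof.
move=> f_inj finA Af; apply: leq_card_fset_set => //.
have : ([set f x | x in `I_T] #= `I_T)%card.
  by apply: inj_card_eq => x y _ _; apply: f_inj.
rewrite card_eq_le => /andP[_ le1]; apply: card_le_trans le1 _.
by apply: subset_card_le => _ [k kT <-]; apply: Af.
Qed.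

Lemma count_upto_lower_bound (R : realType) (A : set quadruple)
    (f : nat -> quadruple) :
  (forall a0 a1 a2 a3, A (a0, a1, a2, a3) ->
     [/\ 0 <= a0, 0 <= a1, 0 <= a2 & 0 <= a3]) ->
  injective f -> (forall k, A (f k)) ->
  (forall k, box ((100 * k.+1) ^ 10) (f k)) ->
  infinite_set A /\
  exists c : R, 0 < c /\
    \forall N \near \oo, c * N%:R `^ (1 / 10) <= (count_upto A N)%:R.
Proof.
move=> A_ge0 f_inj Af boxf; split.
  apply: (@sub_infinite_set _ (range f)); first by move=> _ [k _ <-].
  have eqf : (range f #= [set: nat])%card.
    by apply: inj_card_eq => x y _ _; apply: f_inj.
  by rewrite (eq_finite_set eqf); apply: infinite_nat.
(* With [r] the tenth root of [N], the first [T], the integer part of [r / 100], members of the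
   family fit in the box; [T > r / 100 - 1 >= r / 200] as soon as [r >= 200]. *)
exists (1 / 200); split; first by lra.
near=> N.
set r := N%:R `^ (1 / 10).
have r_ge0 : 0 <= r by apply: powR_ge0.
have r10 : r ^+ 10 = N%:R.
  by rewrite -powR_mulrn // -powRrM mul1r mulVf ?powRr1.
have r_ge : 200 <= r.
  rewrite -(@ler_pXn2r _ 10) ?nnegrE // r10.
  by near: N; apply: nbhs_infty_ger.
pose T := Num.trunc (r / 100).
have leT : (T%:R <= r / 100 :> R) by rewrite Num.Theory.truncn_le divr_ge0.
have ltT : r / 100 < T.+1%:R by apply: Num.Theory.truncnS_gt.
have T_count : (T <= count_upto A N)%N.
  apply: (leq_count_upto f_inj); first exact: finite_box.
  move=> k kT; split; first exact: Af.
  have leN : ((100 * k.+1) ^ 10 <= N)%N.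
    apply: (@leq_trans ((100 * T) ^ 10)); first by rewrite leq_exp2r // leq_mul2l.
    rewrite -(ler_nat R) natrX natrM -r10 ler_pXn2r ?nnegrE //.
    by lra.
  move: (boxf k); case: (f k) => [[[a0 a1] a2] a3] [h0 h1 h2 h3].
  have {}leN : ((100 * k.+1) ^ 10)%N%:Z <= N%:Z by rewrite lez_nat.
  by split; apply: le_trans leN.
rewrite -[T.+1%:R]natr1 in ltT.
apply: (@le_trans _ _ T%:R); last by rewrite ler_nat.
by lra.
Unshelve. all: by end_near.
Qed.

(** * Pairs of progressions of squares with a common difference *)

Definition ap_start (p q : int) : int := (p ^+ 2 - q ^+ 2 - 2 * p * q) ^+ 2.

Definition ap_step (p q : int) : int := 4 * p * q * (p ^+ 2 - q ^+ 2).

(** Measured between the middle terms, whose form is simplest; when the differences agree, the first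
    and last terms are offset by the same amount. *)
Definition ap_offset (p q p' q' : int) : int :=
  (p' ^+ 2 + q' ^+ 2) ^+ 2 - (p ^+ 2 + q ^+ 2) ^+ 2.

Lemma sqr_squares (x : int) : squares (x ^+ 2).
Proof. by exists `|x|%N => //; rewrite abszE real_normK // num_real. Qed.

(** The eight vertices are the six terms of the two progressions, each middle term being reached
    twice. *)
Lemma squares_ap_pair (p q p' q' : int) (e1 e2 e3 : bool) :
  ap_step p q = ap_step p' q' ->
  squares (ap_start p q + e1%:R * ap_step p q + e2%:R * ap_step p q
           + e3%:R * ap_offset p q p' q').
Proof.
rewrite /ap_start /ap_offset => h.
have start_eq p1 q1 :
    (p1 ^+ 2 - q1 ^+ 2 - 2 * p1 * q1) ^+ 2
    = (p1 ^+ 2 + q1 ^+ 2) ^+ 2 - ap_step p1 q1.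
  by rewrite /ap_step; ring.
have end_eq p1 q1 :
    (p1 ^+ 2 - q1 ^+ 2 + 2 * p1 * q1) ^+ 2
    = (p1 ^+ 2 + q1 ^+ 2) ^+ 2 + ap_step p1 q1.
  by rewrite /ap_step; ring.
have sq (y x : int) : x = y ^+ 2 -> squares x by move=> ->; apply: sqr_squares.
case: e3; case: e1; case: e2 => /=.
- by apply: (sq (p' ^+ 2 - q' ^+ 2 + 2 * p' * q')); rewrite start_eq end_eq h; ring.
- by apply: (sq (p' ^+ 2 + q' ^+ 2)); rewrite start_eq; ring.
- by apply: (sq (p' ^+ 2 + q' ^+ 2)); rewrite start_eq; ring.
- by apply: (sq (p' ^+ 2 - q' ^+ 2 - 2 * p' * q')); rewrite !start_eq h; ring.
- by apply: (sq (p ^+ 2 - q ^+ 2 + 2 * p * q)); rewrite start_eq end_eq; ring.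
- by apply: (sq (p ^+ 2 + q ^+ 2)); rewrite start_eq; ring.
- by apply: (sq (p ^+ 2 + q ^+ 2)); rewrite start_eq; ring.
- by apply: (sq (p ^+ 2 - q ^+ 2 - 2 * p * q)); ring.
Qed.

Lemma coprimezMDr (k m n : int) : coprimez m (k * m + n) = coprimez m n.
Proof. by rewrite /coprimez gcdzMDl. Qed.

(** The step is [4pqs] and the start is the square of [x = s - 2pq]. Modulo 2, [p] and [q], [x] is
    [s], which is coprime to them; modulo [s] it is [-2pq]. *)
Lemma coprime_ap (p q : int) :
  coprimez p q -> coprimez 2 (p ^+ 2 - q ^+ 2) ->
  coprimez (ap_start p q) (ap_step p q).
Proof.
move=> cpq c2; set s := p ^+ 2 - q ^+ 2; set x := s - 2 * p * q.
have cqp : coprimez q p by rewrite coprimez_sym.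
have cp : coprimez p s.
  rewrite (_ : s = p * p + - q ^+ 2); last by rewrite /s; ring.
  by rewrite coprimezMDr coprimezN coprimezXr.
have cq : coprimez q s.
  rewrite (_ : s = - q * q + p ^+ 2); last by rewrite /s; ring.
  by rewrite coprimezMDr coprimezXr.
have xp : coprimez p x.
  by rewrite (_ : x = - 2 * q * p + s); [rewrite coprimezMDr|rewrite /x; ring].
have xq : coprimez q x.
  by rewrite (_ : x = - 2 * p * q + s); [rewrite coprimezMDr|rewrite /x; ring].
have x2 : coprimez 2 x.
  by rewrite (_ : x = - p * q * 2 + s); [rewrite coprimezMDr|rewrite /x; ring].
have xs : coprimez s x.
  rewrite (_ : x = 1 * s + - (2 * p * q)); last by rewrite /x; ring.
  by rewrite coprimezMDr coprimezN !coprimezMr ![coprimez s _]coprimez_sym c2 cp cq.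
apply: coprimezXl; rewrite -/s -/x /ap_step (_ : 4 = 2 * 2) // !coprimezMr.
by rewrite ![coprimez x _]coprimez_sym x2 xp xq xs.
Qed.

(** * Progressions from solutions of [m^2 = n^2 + nl + l^2] *)

Lemma ap_stepE (m n l : int) :
  m ^+ 2 = n ^+ 2 + n * l + l ^+ 2 ->
  ap_step m l = 4 * m * n * l * (n + l).
Proof. by move=> mnl; rewrite /ap_step mnl; ring. Qed.

Lemma ap_step_mid (m n l : int) :
  m ^+ 2 = n ^+ 2 + n * l + l ^+ 2 ->
  ap_step m l = ap_step m n.
Proof. by move=> mnl; rewrite (ap_stepE mnl) /ap_step mnl; ring. Qed.

Lemma ap_step_top (m n l : int) :
  m ^+ 2 = n ^+ 2 + n * l + l ^+ 2 ->
  ap_step m l = ap_step (n + l) m.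
Proof. by move=> mnl; rewrite (ap_stepE mnl) /ap_step mnl; ring. Qed.

Lemma ap_step_gt0 (m n l : int) :
  0 < l -> l < n -> n < m -> m ^+ 2 = n ^+ 2 + n * l + l ^+ 2 ->
  0 < ap_step m l.
Proof.
move=> l_gt0 ln nm mnl.
by rewrite (ap_stepE mnl) !mulr_gt0 //; lra.
Qed.

Lemma ap_offset_mid_gt0 (m n l : int) :
  0 < l -> l < n -> n < m -> 0 < ap_offset m l m n.
Proof.
move=> l_gt0 ln nm; rewrite /ap_offset.
have -> : (m ^+ 2 + n ^+ 2) ^+ 2 - (m ^+ 2 + l ^+ 2) ^+ 2
  = (n - l) * (n + l) * (2 * m ^+ 2 + n ^+ 2 + l ^+ 2) by ring.
by rewrite !mulr_gt0 ?subr_gt0 // ?addr_gt0 ?mulr_gt0 ?exprn_gt0 //; lra.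
Qed.

Lemma ap_offset_mid_lt (m n l : int) :
  0 < l -> l < n -> n < m -> m ^+ 2 = n ^+ 2 + n * l + l ^+ 2 ->
  4 * (n - l) < l -> m <= 2 * n -> ap_offset m l m n < ap_step m l.
Proof.
move=> l_gt0 ln nm mnl nl m2n; rewrite (ap_stepE mnl) /ap_offset.
have -> : (m ^+ 2 + n ^+ 2) ^+ 2 - (m ^+ 2 + l ^+ 2) ^+ 2
  = (n - l) * (2 * m ^+ 2 + n ^+ 2 + l ^+ 2) * (n + l) by ring.
rewrite ltr_pM2r; last by lra.
(* The constant 16 is chosen so that [4 * (n - l) < l] turns [16mn(n - l)] into less than [4mnl],
   the step without its factor [n + l]. *)
have S_le : 2 * m ^+ 2 + n ^+ 2 + l ^+ 2 <= 16 * m * n by nra.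
have mn_gt0 : 0 < m * n by rewrite mulr_gt0; lra.
apply: (@le_lt_trans _ _ ((n - l) * (16 * m * n))).
  by rewrite ler_pM2l ?subr_gt0.
by nra.
Qed.

Lemma ap_offset_top_gt (m n l : int) :
  0 < l -> l < n -> n < m -> m ^+ 2 = n ^+ 2 + n * l + l ^+ 2 ->
  ap_step m l < ap_offset m l (n + l) m.
Proof.
move=> l_gt0 ln nm mnl; rewrite (ap_stepE mnl) /ap_offset.
have -> : ((n + l) ^+ 2 + m ^+ 2) ^+ 2 - (m ^+ 2 + l ^+ 2) ^+ 2
  = n * ((n + 2 * l) * (2 * m ^+ 2 + (n + l) ^+ 2 + l ^+ 2)) by ring.
have -> : 4 * m * n * l * (n + l) = n * ((2 * l) * (2 * m * (n + l))) by ring.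
rewrite ltr_pM2l; last by lra.
apply: ltr_pM.
- lra.
- by rewrite !mulr_ge0 //; lra.
- lra.
(* By the arithmetic-geometric mean inequality [2m(n + l) <= m^2 + (n + l)^2]; the remaining
   [m^2 + l^2] makes it strict. *)
- by have := sqr_ge0 (m - (n + l)); nra.
Qed.

(** Everything is at most [y^2], the middle term of the progression of [(n + l, m)], and
    [y <= (m + n + l)^2]. The step is at most [y^2] because [y^2] minus the step is again a
    square. *)
Lemma ap_top_bound (m n l B : int) :
  0 < l -> l < n -> n < m -> m ^+ 2 = n ^+ 2 + n * l + l ^+ 2 ->
  m + (n + l) <= B ->
  [/\ ap_start m l <= B ^+ 4, ap_step m l <= B ^+ 4,
      ap_offset m l m n <= B ^+ 4 & ap_offset m l (n + l) m <= B ^+ 4].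
Proof.
move=> l_gt0 ln nm mnl leB.
set y := (n + l) ^+ 2 + m ^+ 2.
have y_le : y ^+ 2 <= B ^+ 4.
  rewrite (_ : B ^+ 4 = (B ^+ 2) ^+ 2); last by rewrite -exprM.
  rewrite ler_pXn2r ?nnegrE ?sqr_ge0 ?addr_ge0 ?sqr_ge0 //.
  by rewrite /y; nra.
have d_gt0 := ap_step_gt0 l_gt0 ln nm mnl.
have o_gt0 := ap_offset_mid_gt0 l_gt0 ln nm.
have d_le : ap_step m l <= y ^+ 2.
  rewrite (ap_step_top mnl) -subr_ge0.
  rewrite (_ : _ - _ = ((n + l) ^+ 2 - m ^+ 2 - 2 * (n + l) * m) ^+ 2) ?sqr_ge0 //.
  by rewrite /y /ap_step; ring.
have startE : ap_start m l = (m ^+ 2 + l ^+ 2) ^+ 2 - ap_step m l.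
  by rewrite /ap_start /ap_step; ring.
have y1_ge0 := sqr_ge0 (m ^+ 2 + l ^+ 2).
have mid_top : (m ^+ 2 + n ^+ 2) ^+ 2 <= y ^+ 2.
  rewrite ler_pXn2r ?nnegrE ?addr_ge0 ?sqr_ge0 //.
  by rewrite /y; nra.
rewrite startE; move: o_gt0; rewrite /ap_offset -/y => o_gt0.
by split; lra.
Qed.

(** * The one-parameter solution: inequalities and coprimality *)

(* Obtained from [m = a^2 + ab + b^2], [n = a^2 - b^2], [l = 2ab + b^2] with
   [a = 18t + 1], [b = 6t]; the ratio [a / b] is close to [3], so that [n / l] is
   close to [8 / 7]. *)
Definition par_m (t : int) : int := 468 * t ^+ 2 + 42 * t + 1.
Definition par_n (t : int) : int := 288 * t ^+ 2 + 36 * t + 1.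
Definition par_l (t : int) : int := 12 * t * (21 * t + 1).

Lemma par_eq t : par_m t ^+ 2 = par_n t ^+ 2 + par_n t * par_l t + par_l t ^+ 2.
Proof. by rewrite /par_m /par_n /par_l; ring. Qed.

(** The leading coefficients 468, 288, 252 of [m], [n], [l] satisfy these inequalities with enough
    room for the lower terms. *)
Lemma par_ineqs t : 1 <= t ->
  [/\ [/\ 0 < par_l t, par_l t < par_n t & par_n t < par_m t],
      4 * (par_n t - par_l t) < par_l t, par_m t <= 2 * par_n t &
      par_m t + (par_n t + par_l t) <= (100 * t) ^+ 2].
Proof. by move=> t1; rewrite /par_m /par_n /par_l; split; [split|..]; nra. Qed.

Lemma coprime_par t : coprimez (par_m t) (par_l t).
Proof.
set w := 21 * t + 1.
have m1 (k : int) (u : int) : par_m t = u * k + 1 -> coprimez (par_m t) k.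
  by move=> ->; rewrite coprimez_sym coprimezMDr /coprimez gcdz1.
have m2 : coprimez (par_m t) 2.
  by apply: (m1 _ (234 * t ^+ 2 + 21 * t)); rewrite /par_m; ring.
have m3 : coprimez (par_m t) 3.
  by apply: (m1 _ (156 * t ^+ 2 + 14 * t)); rewrite /par_m; ring.
have mt : coprimez (par_m t) t.
  by apply: (m1 _ (468 * t + 42)); rewrite /par_m; ring.
have w3 : coprimez w 3.
  by rewrite coprimez_sym (_ : w = 7 * t * 3 + 1) ?coprimezMDr // /w; ring.
(* At the root [t = -1/21] of [w], [par_m] equals [3/49], so [147 * par_m t] is 9 modulo [w]. *)
have mw : coprimez w (147 * par_m t).
  rewrite (_ : _ * _ = (3276 * t + 138) * w + 3 * 3); last by rewrite /par_m /w; ring.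
  by rewrite coprimezMDr coprimezMr w3.
rewrite coprimezMr in mw; case/andP: mw => _ mw.
rewrite /par_l -/w (_ : 12 = 2 * 2 * 3) // !coprimezMr m2 m3 mt /=.
by rewrite coprimez_sym.
Qed.

Lemma coprime_par_ap t :
  coprimez (ap_start (par_m t) (par_l t)) (ap_step (par_m t) (par_l t)).
Proof.
apply: coprime_ap; first exact: coprime_par.
(* Here [par_m t = 2u + 1] and [par_l t = 2v], so the difference of their squares is odd. *)
set u := 234 * t ^+ 2 + 21 * t; set v := 6 * t * (21 * t + 1).
rewrite (_ : _ - _ = (2 * u ^+ 2 + 2 * u - 2 * v ^+ 2) * 2 + 1) ?coprimezMDr //.
by rewrite /par_m /par_l /u /v; ring.
Qed.

Lemma quad_prod_lt (m n l m' n' l' : int) :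
  0 < l -> l < n -> n < m -> m < m' -> n < n' -> l < l' ->
  4 * m * n * l * (n + l) < 4 * m' * n' * l' * (n' + l').
Proof.
move=> l0 ln nm mm nn ll.
have m0 : 0 < m by lra.
have n0 : 0 < n by lra.
have h1 : 4 * m < 4 * m' by lra.
have h2 : 4 * m * n < 4 * m' * n' by apply: ltr_pM => //; lra.
have h3 : 4 * m * n * l < 4 * m' * n' * l' by apply: ltr_pM => //; nra.
by apply: ltr_pM => //; [rewrite !mulr_ge0 //; lra | lra | lra].
Qed.

(** Monotonicity lets the step alone tell the cubes of either family apart. *)
Lemma ap_step_par_lt s t : 1 <= s -> s < t ->
  ap_step (par_m s) (par_l s) < ap_step (par_m t) (par_l t).
Proof.
move=> s1 st; have t1 : 1 <= t by lra.
have [[ls lns nms] _ _ _] := par_ineqs s1.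
rewrite !(ap_stepE (par_eq _)).
have ltm : par_m s < par_m t by rewrite /par_m; nra.
have ltn : par_n s < par_n t by rewrite /par_n; nra.
have ltl : par_l s < par_l t by rewrite /par_l; nra.
exact: quad_prod_lt.
Qed.

(** * The two families of cubes *)

Section Families.
(** The parameter starts at 1, since [par_l 0 = 0] would give a zero step. *)
Let m (k : nat) := par_m k.+1.
Let n (k : nat) := par_n k.+1.
Let l (k : nat) := par_l k.+1.

Definition tall_cube (k : nat) : quadruple :=
  (ap_start (m k) (l k), ap_step (m k) (l k), ap_step (m k) (l k),
   ap_offset (m k) (l k) (n k + l k) (m k)).

Definition flat_cube (k : nat) : quadruple :=
  (ap_start (m k) (l k), ap_offset (m k) (l k) (m k) (n k),
   ap_step (m k) (l k), ap_step (m k) (l k)).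

Lemma ap_step_par_inj : injective (fun k => ap_step (m k) (l k)).
Proof.
move=> i j; case: (ltngtP i j) => // ij E.
  by have := @ap_step_par_lt i.+1 j.+1 isT ij; rewrite E ltxx.
by have := @ap_step_par_lt j.+1 i.+1 isT ij; rewrite E ltxx.
Qed.

Lemma tall_cube_inj : injective tall_cube.
Proof. by move=> i j [_ _ E _]; apply: ap_step_par_inj. Qed.

Lemma flat_cube_inj : injective flat_cube.
Proof. by move=> i j [_ _ E]; apply: ap_step_par_inj. Qed.

Lemma tall_cubeP k : (reduced_square_cubes `&` first_two_equal) (tall_cube k).
Proof.
have [[l0 ln nm] _ _ _] := @par_ineqs k.+1 isT; have E := par_eq k.+1.
have d0 := ap_step_gt0 l0 ln nm E.
have od := ap_offset_top_gt l0 ln nm E.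
split; last by split.
split.
- exact: sqr_ge0.
- by split; rewrite -gtz0_ge1 ?(lt_trans d0 od).
(* Start and step are already coprime, whatever the offset. *)
- have /eqP c := coprime_par_ap k.+1.
  by rewrite /reduced gcdzA c gcd1z.
- by move=> _ [e1 [e2 [e3 ->]]]; apply: squares_ap_pair; apply: ap_step_top.
Qed.

Lemma flat_cubeP k : (reduced_square_cubes `&` last_two_equal) (flat_cube k).
Proof.
have [[l0 ln nm] nl mn _] := @par_ineqs k.+1 isT; have E := par_eq k.+1.
have d0 := ap_step_gt0 l0 ln nm E.
have o0 := ap_offset_mid_gt0 l0 ln nm.
have od := ap_offset_mid_lt l0 ln nm E nl mn.
split; last by split.
split.
- exact: sqr_ge0.
- by split; rewrite -gtz0_ge1.
- have /eqP c := coprime_par_ap k.+1.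
  by rewrite /reduced [gcdz (ap_offset _ _ _ _) _]gcdzC -gcdzA gcdzA c gcd1z.
- move=> _ [e1 [e2 [e3 ->]]].
  (* The offset is now the first side, so [e1] selects the progression. *)
  rewrite (_ : _ + _ = ap_start (m k) (l k) + e2%:R * ap_step (m k) (l k)
    + e3%:R * ap_step (m k) (l k)
    + e1%:R * ap_offset (m k) (l k) (m k) (n k)); last by ring.
  by apply: squares_ap_pair; apply: ap_step_mid.
Qed.

Lemma box_cubes k :
  box ((100 * k.+1) ^ 10) (tall_cube k) /\ box ((100 * k.+1) ^ 10) (flat_cube k).
Proof.
have [[l0 ln nm] _ _ b] := @par_ineqs k.+1 isT.
have := ap_top_bound l0 ln nm (par_eq k.+1) b; rewrite -exprM.
(* The entries are at most [B^4] with [B = (100 * k.+1)^2]; this eighth power is relaxed to the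
   tenth. *)
have le10 : (100 * k.+1%:Z) ^+ (2 * 4) <= ((100 * k.+1) ^ 10)%N%:Z.
  by rewrite -[leRHS]natz natrX natrM !natz ler_weXn2l.
by case=> h0 h1 h2 h3; split; split; apply: le_trans le10.
Qed.

End Families.

Theorem theorem1p6 (R : realType) :
  (infinite_set (reduced_square_cubes `&` first_two_equal) /\
   exists c : R, 0 < c /\
     \forall N \near \oo,
       c * N%:R `^ (1 / 10) <=
         (count_upto (reduced_square_cubes `&` first_two_equal) N)%:R) /\
  (infinite_set (reduced_square_cubes `&` last_two_equal) /\
   exists c : R, 0 < c /\
     \forall N \near \oo,
       c * N%:R `^ (1 / 10) <=
         (count_upto (reduced_square_cubes `&` last_two_equal) N)%:R).
Proof.
have ge0 (B : set quadruple) a0 a1 a2 a3 :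
    (reduced_square_cubes `&` B) (a0, a1, a2, a3) ->
    [/\ 0 <= a0, 0 <= a1, 0 <= a2 & 0 <= a3].
  have le1 (a : int) : 1 <= a -> 0 <= a by apply: le_trans.
  by case=> -[h0 [h1 h2 h3] _ _] _; split=> //; apply: le1.
split.
  apply: (@count_upto_lower_bound _ _ tall_cube); first exact: ge0.
  - exact: tall_cube_inj.
  - exact: tall_cubeP.
  - by move=> k; have [] := box_cubes k.
apply: (@count_upto_lower_bound _ _ flat_cube); first exact: ge0.
- exact: flat_cube_inj.
- exact: flat_cubeP.
- by move=> k; have [] := box_cubes k.
Qed.
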